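(* Let $R$ be a ring and let $J$ be a finite nilpotent (two-sided) ideal of $R$ whose additive group is a $2$-group. Let $e\in R$ satisfy $e^2=e$, put $f=1-e$, and set $A=eJe$, $M=eJf$, $N=fJe$, $B=fJf$. If $M\neq0$, $N\neq0$ and $J^3\neq0$, then $$|J|=|A|\,|M|\,|N|\,|B|\geq 32.$$
   Context: All rings are associative with identity; $R$ itself is not assumed finite here. For idempotents $g,h\in\{e,f\}$, $gJh=\{gjh: j\in J\}$, an additive subgroup of $J$. $J$ is nilpotent if $J^k=0$ for some $k\ge1$, where $J^k$ is the additive subgroup generated by all products of $k$ elements of $J$; in particular $J^3\neq0$ means that some product $xyz$ with $x,y,z\in J$ is nonzero. The additive group of $J$ being a $2$-group means that its order is a power of $2$. *)

(* Defs.v *)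
From HB Require Import structures.
From mathcomp Require Import all_boot all_order all_algebra finmap.
From mathcomp Require Import boolp classical_sets functions cardinality.
Set Implicit Arguments.
Unset Strict Implicit.
Unset Printing Implicit Defensive.
Import GRing.Theory.
Local Open Scope classical_set_scope.
Local Open Scope ring_scope.

Section Ideals.
Variable R : pzRingType.
Implicit Types (J S : set R) (g h : R).

Definition two_sided_ideal J : Prop :=
  zmod_closed (mem J) /\
  (forall r x : R, x \in J -> r * x \in J /\ x * r \in J).

Definition products J (k : nat) : set R :=
  [set \prod_(i < k) u i | u in [set u : 'I_k -> R | forall i, u i \in J]].

Definition add_subgroup_gen S : set R :=
  smallest [set G : set R | zmod_closed (mem G)] S.

Definition ideal_pow J (k : nat) : set R := add_subgroup_gen (products J k).

Definition nilpotent_ideal J : Prop :=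
  exists2 k : nat, (1 <= k)%N & ideal_pow J k = [set 0].

Definition corner g J h : set R := [set g * j * h | j in J].

(* Only meaningful for finite S: fset_set sends infinite sets to fset0. *)
Definition card_set S : nat := #|` fset_set S |.

Definition additive_2group J : Prop := exists m : nat, card_set J = (2 ^ m)%N.

End Ideals.

(* Main.v *)
(* By the Peirce decomposition J = A + M + N + B (a direct sum), a nonzero
   product of three elements of J yields a nonzero product x y z with each
   factor in a Peirce component.  If a in J and x <> 0, then x is not in Jx by
   nilpotency, so the subgroup {a x : a in gJg} of gJh is proper and gJh has at
   least twice its cardinality; symmetrically on the right.  Whatever
   components x, y, z lie in, these doublings account for a factor 32. *)

Require Import Defs.
From HB Require Import structures.
From mathcomp Require Import all_boot all_order all_algebra finmap.
From mathcomp Require Import boolp classical_sets functions cardinality.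
Set Implicit Arguments.
Unset Strict Implicit.
Unset Printing Implicit Defensive.
Import GRing.Theory.
Local Open Scope classical_set_scope.
Local Open Scope ring_scope.

(** * Cardinalities of finite sets and additive subgroups *)

Lemma card_set_image (T U : choiceType) (h : T -> U) (X : set T) :
  finite_set X -> {in X &, injective h} ->
  #|` fset_set [set h x | x in X]| = #|` fset_set X|.
Proof.
move=> Xfin h_inj; rewrite fset_set_image// card_in_imfset// => u v.
by rewrite !in_fset_set//; exact: h_inj.
Qed.

Lemma card_set_setX (T U : choiceType) (X : set T) (Y : set U) :
  finite_set X -> finite_set Y ->
  #|` fset_set (X `*` Y)| = (#|` fset_set X| * #|` fset_set Y|)%N.
Proof.
move=> Xfin Yfin; rewrite fset_setX//.
rewrite (perm_size (enum_imfset2 _ _)) ?size_allpairs//.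
by move=> [x y] [x' y'] _ _ /= [-> ->].
Qed.

Lemma zmod_closed_setP (V : zmodType) (P : set V) :
  zmod_closed (mem P) <-> P 0 /\ (forall u v, P u -> P v -> P (u - v)).
Proof.
split=> [[P0 PB]|[P0 PB]]; split.
- exact: set_mem P0.
- by move=> u v Pu Pv; apply: set_mem (PB u v _ _); apply: mem_set.
- exact: mem_set P0.
- by move=> u v /set_mem Pu /set_mem Pv; apply: mem_set (PB u v Pu Pv).
Qed.

Lemma zmod_closed_setD (V : zmodType) (P : set V) :
  zmod_closed (mem P) -> forall u v, P u -> P v -> P (u + v).
Proof.
move=> /zmod_closed_setP[P0 PB] u v Pu Pv; rewrite -[v]opprK -[- v]sub0r.
by apply: (PB) => //; apply: PB.
Qed.

Lemma zmod_closed_set0 (V : zmodType) : zmod_closed (mem [set 0 : V]).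
Proof. by apply/zmod_closed_setP; split=> // _ _ -> ->; rewrite subrr. Qed.

Lemma card_set_gt0 (V : pzRingType) (P : set V) x :
  finite_set P -> P x -> (0 < card_set P)%N.
Proof.
move=> Pfin Px; rewrite /card_set cardfs_gt0; apply/fset0Pn; exists x.
by rewrite in_fset_set//; exact: mem_set.
Qed.

(** If [x] lies outside the subgroup [P], then [P] and its coset [x + P] are disjoint and both sit
    inside [Q]. *)
Lemma card_set_double (V : pzRingType) (P Q : set V) x :
  zmod_closed (mem P) -> zmod_closed (mem Q) ->
  finite_set Q -> (P `<=` Q)%classic -> Q x -> ~ P x ->
  ((card_set P).*2 <= card_set Q)%N.
Proof.
move=> /zmod_closed_setP[P0 PB] /zmod_closed_setD QD Qfin PQ Qx Px.
have Pfin : finite_set P := sub_finite_set PQ Qfin.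
pose xP := [set x + u | u in P].
have xPfin : finite_set xP by exact: finite_image.
have cardxP : card_set xP = card_set P.
  by rewrite /card_set card_set_image// => u v _ _; exact: addrI.
have disj : [disjoint fset_set P & fset_set xP]%fset.
  apply/fdisjointP=> u; rewrite !in_fset_set// => /set_mem Pu.
  apply/negP=> /set_mem[v Pv def_u]; apply: Px.
  by rewrite -(addrK v x) def_u; apply: PB.
rewrite -addnn -[X in (_ + X <= _)%N]cardxP /card_set.
have [_] := leq_card_fsetU (fset_set P) (fset_set xP).
rewrite disj => /eqP <-.
apply: fsubset_leq_card; rewrite fsubUset; apply/andP.
split; rewrite -fset_set_sub//.
by move=> _ [u Pu <-]; apply: QD => //; apply: PQ.
Qed.

Lemma zmod_closed_image (V W : zmodType) (h : V -> W) (P : set V) :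
  {morph h : u v / u - v} -> zmod_closed (mem P) ->
  zmod_closed (mem [set h u | u in P]).
Proof.
move=> hB /zmod_closed_setP[P0 PB]; apply/zmod_closed_setP; split.
  by exists 0 => //; rewrite -{1}(subrr 0) hB subrr.
by move=> _ _ [u Pu <-] [v Pv <-]; exists (u - v); [exact: PB | exact: hB].
Qed.

Lemma card_set_gt1 (V : pzRingType) (P : set V) x : zmod_closed (mem P) ->
  finite_set P -> P x -> x <> 0 -> (2 <= card_set P)%N.
Proof.
move=> Pz Pfin Px xN0; have [P0 _] := (zmod_closed_setP P).1 Pz.
have zero_zmod := zmod_closed_set0 V.
have -> : 2%N = (card_set [set 0 : V]).*2.
  by rewrite /card_set fset_set1 cardfs1.
by apply: card_set_double Px xN0 => // _ ->.
Qed.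

(** * Finite nilpotent ideals and strict inclusions *)

Section NilpotentIdeal.
Variables (R : pzRingType) (J : set R).
Hypothesis J_ideal : two_sided_ideal J.
Hypothesis J_finite : finite_set J.
Hypothesis J_nilpotent : nilpotent_ideal J.

Lemma ideal_zmod_closed : zmod_closed (mem J).
Proof. exact: J_ideal.1. Qed.

Lemma ideal_mull r x : J x -> J (r * x).
Proof. by move=> /mem_set /(J_ideal.2 r)[/set_mem]. Qed.

Lemma ideal_mulr r x : J x -> J (x * r).
Proof. by move=> /mem_set /(J_ideal.2 r)[_ /set_mem]. Qed.

Lemma nilpotent_ideal_expr a : J a -> exists k, a ^+ k = 0.
Proof.
move=> Ja; have [k _ Jk] := J_nilpotent; exists k.
suff : ideal_pow J k (a ^+ k) by rewrite Jk.
apply: sub_gen_smallest; exists (fun=> a); first by move=> i; apply: mem_set.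
by rewrite prodr_const card_ord.
Qed.

(** Iterating the equation gives [a ^+ n * x = x] for every [n], and [a] is nilpotent. *)
Lemma mull_fixed_eq0 a x : J a -> a * x = x -> x = 0.
Proof.
move=> /nilpotent_ideal_expr[k ak0] ax.
have axn n : a ^+ n * x = x.
  by elim: n => [|n IHn]; rewrite ?expr0 ?mul1r // exprSr -mulrA ax.
by rewrite -(axn k) ak0 mul0r.
Qed.

Lemma mulr_fixed_eq0 a x : J a -> x * a = x -> x = 0.
Proof.
move=> /nilpotent_ideal_expr[k ak0] xa.
have xan n : x * a ^+ n = x.
  by elim: n => [|n IHn]; rewrite ?expr0 ?mulr1 // exprS mulrA xa.
by rewrite -(xan k) ak0 mulr0.
Qed.

(** The subgroup [P x] of [Q] misses [x], since [a * x = x] with [a] in [J] would force [x = 0];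
    hence its index is at least 2. [Q] is left general so that it can itself be a set of multiples,
    as in [leq_card_peirce8]. *)
Lemma card_set_mull (P Q : set R) x : (P `<=` J)%classic ->
  zmod_closed (mem P) -> zmod_closed (mem Q) -> finite_set Q ->
  (forall a, P a -> Q (a * x)) -> Q x -> x <> 0 ->
  ((card_set [set (a * x)%R | a in P]).*2 <= card_set Q)%N.
Proof.
move=> PJ Pz Qz Qfin PxQ Qx xN0; apply: (@card_set_double _ _ _ x) => //.
- by apply: zmod_closed_image Pz => u v; rewrite mulrBl.
- by move=> _ [a Pa <-]; apply: PxQ.
- by move=> [a Pa] /(mull_fixed_eq0 (PJ a Pa)).
Qed.

Lemma card_set_mulr (P Q : set R) x : (P `<=` J)%classic ->
  zmod_closed (mem P) -> zmod_closed (mem Q) -> finite_set Q ->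
  (forall a, P a -> Q (x * a)) -> Q x -> x <> 0 ->
  ((card_set [set (x * a)%R | a in P]).*2 <= card_set Q)%N.
Proof.
move=> PJ Pz Qz Qfin PxQ Qx xN0; apply: (@card_set_double _ _ _ x) => //.
- by apply: zmod_closed_image Pz => u v; rewrite mulrBr.
- by move=> _ [a Pa <-]; apply: PxQ.
- by move=> [a Pa] /(mulr_fixed_eq0 (PJ a Pa)).
Qed.

(** If all triple products vanished, the zero subgroup would contain every generator of the third
    power. *)
Lemma ideal_pow3_neq0 : ideal_pow J 3 <> [set 0] ->
  exists x y z, [/\ J x, J y, J z & x * y * z <> 0].
Proof.
move=> J3; apply: contrapT => noprod; apply: J3.
have zero_zmod := zmod_closed_set0 R.
rewrite eqEsubset; split.
  apply: smallest_sub => // _ [u Ju <-]; apply: contrapT => uN0.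
  apply: noprod; exists (u 0), (u 1), (u 2%:R); split; try exact: set_mem.
  move=> u0; apply: uN0; rewrite /= -u0 !big_ord_recl big_ord0 mulr1 mulrA.
  by congr (u _ * u _ * u _); apply: val_inj.
by move=> _ -> G [/zmod_closed_setP[]].
Qed.

(** * Peirce decomposition for two orthogonal idempotents *)

Section Peirce.
(** Indexing the idempotents by booleans treats the four components uniformly and turns the exchange
    of e and f into negation. *)
Variable c : bool -> R.
Hypothesis c_orth : forall i j, c i * c j = if i == j then c i else 0.
Hypothesis c_sum : c true + c false = 1.

Let C i j := corner (c i) J (c j).

Lemma peirceP i j x : C i j x <-> [/\ J x, c i * x = x & x * c j = x].
Proof.
split=> [[u Ju <-]|[Jx cx xc]]; last by exists x; rewrite ?cx.
split; first by apply/ideal_mulr/ideal_mull.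
  by rewrite !mulrA c_orth eqxx.
by rewrite -mulrA c_orth eqxx.
Qed.

Lemma peirce_sub i j : (C i j `<=` J)%classic.
Proof. by move=> x /peirceP[]. Qed.

Lemma peirce_finite i j : finite_set (C i j).
Proof. exact: finite_image. Qed.

Lemma peirce_zmod i j : zmod_closed (mem (C i j)).
Proof.
apply: zmod_closed_image ideal_zmod_closed => u v.
by rewrite mulrBr mulrBl.
Qed.

Lemma peirce_mul i j k x y : C i j x -> C j k y -> C i k (x * y).
Proof.
move=> /peirceP[Jx cx _] /peirceP[Jy _ yc]; apply/peirceP; split.
- exact: ideal_mulr.
- by rewrite mulrA cx.
- by rewrite -mulrA yc.
Qed.

Lemma peirce_proj i j k l x : C k l x ->
  c i * x * c j = if (i == k) && (j == l) then x else 0.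
Proof.
move=> /peirceP[_ cx xc]; rewrite -{1}cx mulrA c_orth.
case: eqP => [->|_] /=; last by rewrite !mul0r.
rewrite cx -{1}xc -mulrA c_orth [l == j]eq_sym.
by case: eqP; rewrite ?xc ?mulr0.
Qed.

(** Addition is a bijection from the product of the four components onto [J]: surjective by
    multiplying by [c true + c false = 1] on both sides, injective because the components of a sum
    are recovered by [peirce_proj]. *)
Lemma card_peirce : card_set J =
  (card_set (C true true) * card_set (C true false)
   * card_set (C false true) * card_set (C false false))%N.
Proof.
pose h (t : R * R * R * R) := let: (a, m, n, b) := t in a + m + n + b.
have -> : J = [set h t | t in C true true `*` C true false
                              `*` C false true `*` C false false].
  rewrite eqEsubset; split=> [x Jx|_ [[[[a m] n] b] [[[/= Ca Cm] Cn] Cb] <-]].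
    exists (c true * x * c true, c true * x * c false,
            c false * x * c true, c false * x * c false).
      by do !split; exists x.
    by rewrite /= -!mulrDr -addrA -!mulrDr c_sum !mulr1 -mulrDl c_sum mul1r.
  have JD := zmod_closed_setD ideal_zmod_closed.
  apply: (JD _ _ _ (peirce_sub Cb)); apply: (JD _ _ _ (peirce_sub Cn)).
  by apply: (JD _ _ (peirce_sub Ca)); exact: peirce_sub Cm.
have fin2 := finite_setX (peirce_finite true true) (peirce_finite true false).
have fin3 := finite_setX fin2 (peirce_finite false true).
have fin4 := finite_setX fin3 (peirce_finite false false).
rewrite /card_set card_set_image//.
  by rewrite !card_set_setX//; exact: peirce_finite.
move=> [[[a m] n] b] [[[a' m'] n'] b'] /set_mem[[[/= Ca Cm] Cn] Cb].
move=> /set_mem[[[/= Ca' Cm'] Cn'] Cb'] eq_h.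
have proj i j : c i * (a + m + n + b) * c j = c i * (a' + m' + n' + b') * c j.
  by rewrite eq_h.
congr (_, _, _, _); [move: (proj true true) | move: (proj true false)
  | move: (proj false true) | move: (proj false false)];
  by rewrite !(mulrDl, mulrDr) (peirce_proj _ _ Ca) (peirce_proj _ _ Cm)
    (peirce_proj _ _ Cn) (peirce_proj _ _ Cb) (peirce_proj _ _ Ca')
    (peirce_proj _ _ Cm') (peirce_proj _ _ Cn') (peirce_proj _ _ Cb')
    /= ?(addr0, add0r).
Qed.

Lemma peirce_split u v : u * v <> 0 -> exists i, u * c i * v <> 0.
Proof.
move=> uvN0; apply: contrapT => noi; apply: uvN0.
have uc0 i : u * c i * v = 0.
  by apply: contrapT => ucN0; apply: noi; exists i.
by rewrite -[u]mulr1 -c_sum mulrDr mulrDl !uc0 addr0.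
Qed.

(** The sum [c true + c false = 1] is inserted before, between and after the three factors; at each
    of the four places some idempotent keeps the product nonzero. *)
Lemma peirce_product x y z : J x -> J y -> J z -> x * y * z <> 0 ->
  exists i j k l x' y' z',
    [/\ C i j x', C j k y', C k l z' & x' * y' * z' <> 0].
Proof.
move=> Jx Jy Jz xyzN0.
have [i] : exists i, 1 * c i * (x * y * z) <> 0.
  by apply: peirce_split; rewrite mul1r.
rewrite mul1r -[x * y * z]mulrA mulrA => /peirce_split[j].
rewrite mulrA => /peirce_split[k].
rewrite -[X in X <> _]mulr1 => /peirce_split[l].
rewrite mulr1 => prodN0.
exists i, j, k, l, (c i * x * c j), (c j * y * c k), (c k * z * c l).
split; [by exists x | by exists y | by exists z | ].
(* The inner idempotents [c j] and [c k] occur twice in a row, and each pair collapses. *)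
by rewrite !mulrA -[_ * c j * c j]mulrA -[_ * c k * c k]mulrA !c_orth !eqxx.
Qed.

(** * Lower bounds for single components *)

Lemma leq_card_peirce2 i j x : C i j x -> x <> 0 -> (2 <= card_set (C i j))%N.
Proof.
by apply: card_set_gt1; [exact: peirce_zmod | exact: peirce_finite].
Qed.

Lemma peirce_card_mull i j x : C i j x -> x <> 0 ->
  ((card_set [set (a * x)%R | a in C i i]).*2 <= card_set (C i j))%N.
Proof.
move=> Cx; apply: card_set_mull => //; first exact: peirce_sub.
- exact: peirce_zmod.
- exact: peirce_zmod.
- exact: peirce_finite.
- by move=> a Ca; apply: peirce_mul Cx.
Qed.

Lemma peirce_card_mulr i j x : C i j x -> x <> 0 ->
  ((card_set [set (x * a)%R | a in C j j]).*2 <= card_set (C i j))%N.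
Proof.
move=> Cx; apply: card_set_mulr => //; first exact: peirce_sub.
- exact: peirce_zmod.
- exact: peirce_zmod.
- exact: peirce_finite.
- by move=> a Ca; apply: peirce_mul Ca.
Qed.

Lemma card_peirce_neq0 i j : C i j <> [set 0] -> (2 <= card_set (C i j))%N.
Proof.
move=> CN0; have [C0 _] := (zmod_closed_setP _).1 (peirce_zmod i j).
apply: contrapT => small; apply: CN0; rewrite eqEsubset.
split=> [u Cu|_ -> //]; apply: contrapT => uN0.
by apply: small; exact: leq_card_peirce2 uN0.
Qed.

(** With [C i i x] the set of left multiples of [x], both inclusions in 0 < [C i i x] < [C i j] are
    strict: the first because [a * x] is nonzero, the second by nilpotency. *)
Lemma leq_card_peirce4l i j a x : C i i a -> C i j x -> a * x <> 0 ->
  (4 <= card_set (C i j))%N.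
Proof.
move=> Ca Cx axN0; have xN0 : x <> 0 by move=> x0; rewrite x0 mulr0 in axN0.
apply: leq_trans (peirce_card_mull Cx xN0); rewrite (leq_double 2).
apply: card_set_gt1 axN0; last by exists a.
  by apply: zmod_closed_image (peirce_zmod _ _) => u v; rewrite mulrBl.
by apply: finite_image; exact: peirce_finite.
Qed.

Lemma leq_card_peirce4r i j x a : C i j x -> C j j a -> x * a <> 0 ->
  (4 <= card_set (C i j))%N.
Proof.
move=> Cx Ca xaN0; have xN0 : x <> 0 by move=> x0; rewrite x0 mul0r in xaN0.
apply: leq_trans (peirce_card_mulr Cx xN0); rewrite (leq_double 2).
apply: card_set_gt1 xaN0; last by exists a.
  by apply: zmod_closed_image (peirce_zmod _ _) => u v; rewrite mulrBr.
by apply: finite_image; exact: peirce_finite.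
Qed.

(** Writing C for [C i i], the chain 0 < C y z < C z < C has three strict inclusions: C y z contains
    [x * y * z], C z contains [y * z] while C y z does not, and C contains [z] while C z does
    not. *)
Lemma leq_card_peirce8 i x y z : C i i x -> C i i y -> C i i z ->
  x * y * z <> 0 -> (8 <= card_set (C i i))%N.
Proof.
move=> Cx Cy Cz xyzN0.
have yzN0 : y * z <> 0 by move=> yz0; rewrite -mulrA yz0 mulr0 in xyzN0.
have zN0 : z <> 0 by move=> z0; rewrite z0 mulr0 in yzN0.
have zmodC u : zmod_closed (mem [set a * u | a in C i i]).
  by apply: zmod_closed_image (peirce_zmod _ _) => a b; rewrite mulrBl.
have finC u : finite_set [set a * u | a in C i i].
  by apply: finite_image; exact: peirce_finite.
apply: leq_trans (peirce_card_mull Cz zN0); rewrite (leq_double 4).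
have leCyz : ((card_set [set (a * (y * z))%R | a in C i i]).*2
              <= card_set [set (a * z)%R | a in C i i])%N.
  apply: card_set_mull => //; first exact: peirce_sub.
  - exact: peirce_zmod.
  - by move=> a Ca; exists (a * y); [exact: peirce_mul Cy | rewrite mulrA].
  - by exists y.
apply: leq_trans leCyz; rewrite (leq_double 2).
by apply: card_set_gt1 xyzN0 => //; exists x; rewrite ?mulrA.
Qed.

(** The exponents count the doublings found in each component; five in total suffice. *)
Lemma leq_prod32 p q r s a m n b :
  (2 ^ p <= a)%N -> (2 ^ q <= m)%N -> (2 ^ r <= n)%N -> (2 ^ s <= b)%N ->
  (5 <= p + q + r + s)%N -> (32 <= a * m * n * b)%N.
Proof.
move=> pa qm rn sb; rewrite -(leq_exp2l _ _ (ltnSn 1)).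
by move=> /leq_trans-> //; rewrite !expnD !leq_mul.
Qed.

(** The indices are described relative to the starting index [i], with [i'] for the other one, so
    eight cases cover sixteen index sequences up to exchanging the idempotents. *)
Lemma leq_card_peirce_prod i i' j k l x y z :
  j = i \/ j = i' -> k = i \/ k = i' -> l = i \/ l = i' ->
  C i j x -> C j k y -> C k l z -> x * y * z <> 0 ->
  C i i' <> [set 0] -> C i' i <> [set 0] ->
  (32 <= card_set (C i i) * card_set (C i i')
         * card_set (C i' i) * card_set (C i' i'))%N.
Proof.
move=> ij ik il Cx Cy Cz xyzN0 /card_peirce_neq0 M2 /card_peirce_neq0 N2.
have xyN0 : x * y <> 0 by move=> xy0; rewrite xy0 mul0r in xyzN0.
have yzN0 : y * z <> 0 by move=> yz0; rewrite -mulrA yz0 mulr0 in xyzN0.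
have xN0 : x <> 0 by move=> x0; rewrite x0 mul0r in xyN0.
have yN0 : y <> 0 by move=> y0; rewrite y0 mul0r in yzN0.
have zN0 : z <> 0 by move=> z0; rewrite z0 mulr0 in yzN0.
have x_yzN0 : x * (y * z) <> 0 by rewrite mulrA.
have Cxy := peirce_mul Cx Cy; have Cyz := peirce_mul Cy Cz.
have x2 := leq_card_peirce2 Cx xN0; have y2 := leq_card_peirce2 Cy yN0.
have z2 := leq_card_peirce2 Cz zN0; have yz2 := leq_card_peirce2 Cyz yzN0.
have xy2 := leq_card_peirce2 Cxy xyN0.
have leq1 p q : (2 ^ 0 <= card_set (C p q))%N.
  have [C0 _] := (zmod_closed_setP _).1 (peirce_zmod p q).
  exact: card_set_gt0 (peirce_finite p q) C0.
(* In each case [p], [q], [r], [s] are the exponents for [C i i], [C i i'], [C i' i], [C i' i'].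
   Bounds not passed explicitly are found among the hypotheses: [M2], [N2], the bounds from nonzero
   factors or subproducts, and [leq1]. *)
case: ij => ?; case: ik => ?; case: il => ?; subst j k l.
- exact: (leq_prod32 (p := 3) (q := 1) (r := 1) (s := 0)
    (leq_card_peirce8 Cx Cy Cz xyzN0)).
- exact: (leq_prod32 (p := 2) (q := 2) (r := 1) (s := 0)
    (leq_card_peirce4l Cx Cy xyN0) (leq_card_peirce4l Cy Cz yzN0)).
- exact: (leq_prod32 (p := 2) (q := 2) (r := 1) (s := 0)
    (leq_card_peirce4l Cx Cyz x_yzN0) (leq_card_peirce4l Cx Cy xyN0)).
- exact: (leq_prod32 (p := 1) (q := 2) (r := 1) (s := 1)
    x2 (leq_card_peirce4l Cx Cy xyN0)).
- exact: (leq_prod32 (p := 2) (q := 1) (r := 2) (s := 0)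
    (leq_card_peirce4r Cxy Cz xyzN0) x2 (leq_card_peirce4r Cy Cz yzN0)).
(* No factor is diagonal here: the diagonal components are seen to be nonzero through [x * y] and
   [y * z]. *)
- exact: (leq_prod32 (p := 1) (q := 2) (r := 1) (s := 1)
    xy2 (leq_card_peirce4l Cxy Cz xyzN0)).
(* In the last two cases the product gives no nonzero element of [C i i], so the other three
   components supply all five doublings. *)
- exact: (leq_prod32 (p := 0) (q := 2) (r := 2) (s := 1)
    (leq1 _ _) (leq_card_peirce4r Cx Cy xyN0) (leq_card_peirce4l Cy Cz yzN0)).
- exact: (leq_prod32 (p := 0) (q := 2) (r := 1) (s := 2)
    (leq1 _ _) (leq_card_peirce4r Cx Cy xyN0) N2
    (leq_card_peirce4l Cy Cz yzN0)).
Qed.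

End Peirce.
End NilpotentIdeal.

Theorem theorem4p1 (R : pzRingType) (J : set R) (e : R)
    (J_ideal : two_sided_ideal J)
    (J_finite : finite_set J)
    (J_nilpotent : nilpotent_ideal J)
    (J_2group : additive_2group J)
    (e_idempotent : e ^+ 2 = e) :
  let f := 1 - e in
  let A := corner e J e in
  let M := corner e J f in
  let N := corner f J e in
  let B := corner f J f in
  M <> [set 0] -> N <> [set 0] -> ideal_pow J 3 <> [set 0] ->
  card_set J = (card_set A * card_set M * card_set N * card_set B)%N /\
  (32 <= card_set J)%N.
Proof.
move=> f A M N B M_neq0 N_neq0 J3_neq0.
pose c (i : bool) := if i then e else f.
have ee : e * e = e by rewrite -expr2.
have c_orth i j : c i * c j = if i == j then c i else 0.
  case: i; case: j; rewrite /= /f ?mulrBr ?mulrBl ?mulr1 ?mul1r ee;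
    by rewrite ?subrr ?subr0.
have c_sum : c true + c false = 1 by rewrite addrC subrK.
have cardJ := card_peirce J_ideal J_finite c_orth c_sum.
split; first exact: cardJ.
have [x [y [z [Jx Jy Jz xyzN0]]]] := ideal_pow3_neq0 J3_neq0.
have [i [j [k [l [x' [y' [z' [Cx Cy Cz prodN0]]]]]]]] :=
  peirce_product c_orth c_sum Jx Jy Jz xyzN0.
(* Each index is [i] or its negation, so [~~ i] serves as [i']. *)
have bool2 b b' : b = b' \/ b = ~~ b'.
  by case: b; case: b'; [left | right | right | left].
have := leq_card_peirce_prod J_ideal J_finite J_nilpotent c_orth
  (bool2 j i) (bool2 k i) (bool2 l i) Cx Cy Cz prodN0.
rewrite cardJ; case: i Cx => _ ge32; first exact: ge32.
(* For [i = false] the roles of e and f are exchanged: the bound concerns the product in the order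
   B, N, M, A and has to be reordered. *)
have := ge32 N_neq0 M_neq0.
by rewrite mulnC [X in (_ * X)%N]mulnC [X in (_ * (_ * X))%N]mulnC !mulnA.
Qed.
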